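(* Let $p$, $q$ and $r$ be distinct primes and let $G$ be a finite group in $\mathfrak{A}_p\mathfrak{A}_q\mathfrak{A}_r$ with trivial centre. Write $G = PQR$, where $P$ is the normal Sylow $p$-subgroup of $G$, $Q$ is a Sylow $q$-subgroup and $R$ is a Sylow $r$-subgroup of $G$, such that $P$, $Q$, $R$ are elementary abelian, $QR$ is a subgroup of $G$ lying in $\mathfrak{A}_q\mathfrak{A}_r$, and $PQ$ is normal in $G$. Let $H = QR$ and regard $P$ as an $\mathbf{F}_pH$-module via the conjugation action of $H$ on $P$. Then: (i) $P = P_1 \oplus P_2$, where $P_1$ and $P_2$ are $\mathbf{F}_pH$-submodules of $P$ with $$P_1 = \{ x \in P \mid h(x) = x \text{ for all } h \in Q \}.$$ Further, $P_1$ has no non-zero trivial $R$-submodule and $P_2$ does not have any non-zero trivial $Q$-submodule. (ii) Let $P_1, P_2$ be as in (i). If $P'$ is an $\mathbf{F}_pH$-module such that $P' = P_1' \oplus P_2'$ for $\mathbf{F}_pH$-submodules $P_1', P_2'$ of $P'$, where $$P_1' = \{ x \in P' \mid h(x) = x \text{ for all } h \in Q \},$$ then $P \cong P'$ as $\mathbf{F}_pH$-modules if and only if $P_1 \cong P_1'$ and $P_2 \cong P_2'$ as $\mathbf{F}_pH$-modules.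
   Context: For a positive integer $n$, $\mathfrak{A}_n$ denotes the variety of abelian groups of exponent dividing $n$. For varieties of groups $\mathfrak{B}, \mathfrak{C}$, the product variety $\mathfrak{B}\mathfrak{C}$ is the class of all groups $G$ that have a normal subgroup $N$ with $N \in \mathfrak{B}$ and $G/N \in \mathfrak{C}$. This product is associative, so $\mathfrak{A}_p\mathfrak{A}_q\mathfrak{A}_r$ is well defined. $\mathbf{F}_p$ is the field with $p$ elements; the elementary abelian $p$-group $P$ is viewed (additively) as an $\mathbf{F}_p$-vector space, and $h(x)$ denotes the action of $h$ on $x$. For a subgroup $K \le H$, a trivial $K$-submodule is an $\mathbf{F}_pK$-submodule on which every element of $K$ acts as the identity. Sylow subgroups and elementary abelian groups are allowed to be trivial. *)

(* Defs.v *)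
From HB Require Import structures.
From mathcomp Require Import all_boot all_order all_algebra all_fingroup all_solvable.

Set Implicit Arguments.
Unset Strict Implicit.
Unset Printing Implicit Defensive.

Import GRing.Theory.

Local Open Scope group_scope.

(* Varieties are represented by the classes of their finite members.  Subgroups
   and quotients of a finite group are finite, so for finite groups the product
   below is membership in the product variety. *)
Definition fin_group_class := forall gT : finGroupType, {group gT} -> Prop.

Definition abelian_variety (n : nat) : fin_group_class :=
  fun gT G => abelian G && (exponent G %| n).

Definition variety_prod (B C : fin_group_class) : fin_group_class :=
  fun gT G => exists N : {group gT}, [/\ N <| G, B gT N & C _ (G / N)%G].

(* As for mx_representation, the action is only constrained on H.  There is no
   finiteness assumption on the underlying space. *)
Record fg_module (F : fieldType) (gT : finGroupType) (H : {group gT}) :=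
  FGModule {
    fg_sort :> lmodType F;
    fg_act : gT -> fg_sort -> fg_sort;
    fg_act_linear : {in H, forall h, linear (fg_act h)};
    fg_act1 : forall x, fg_act 1 x = x;
    fg_actM : {in H &, forall g h x, fg_act (g * h) x = fg_act g (fg_act h x)}
  }.
Arguments fg_act {F gT H} M h x : rename.

Section FGModules.

Variables (F : fieldType) (gT : finGroupType) (H : {group gT}).
Implicit Types (M N : fg_module F H) (K : {group gT}).

Definition fg_stable K M (U : {pred M}) : Prop :=
  {in K, forall h, {in U, forall x, fg_act M h x \in U}}.

Record fg_submod M := FGSubmod {
  fg_submod_pred :> submodClosed M;
  fg_submod_stable : fg_stable H fg_submod_pred
}.

Definition fg_iso M N : Prop :=
  exists2 f : {linear M -> N}, bijective f
    & {in H, forall h x, f (fg_act M h x) = fg_act N h (f x)}.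

Definition fg_direct_sum M (U W : fg_submod M) : Prop :=
  (forall x : M, exists u w, [/\ u \in U, w \in W & x = (u + w)%R])
  /\ (forall x : M, x \in U -> x \in W -> x = 0%R).

Definition fg_trivial_on K M (U : {pred M}) : Prop :=
  {in K, forall h, {in U, forall x, fg_act M h x = x}}.

Definition no_nonzero_trivial_submod K M (U : fg_submod M) : Prop :=
  forall S : submodClosed M,
    {subset S <= U} -> fg_stable K S -> fg_trivial_on K S ->
    {in S, forall x, x = 0%R}.

Definition is_fixed_submod K M (U : fg_submod M) : Prop :=
  forall x : M, x \in U <-> {in K, forall h, fg_act M h x = x}.

End FGModules.

Section SubModule.

Variables (F : fieldType) (gT : finGroupType) (H : {group gT}).
Variables (M : fg_module F H) (U : fg_submod M).

Definition fg_submod_type : Type := {x : M | x \in U}.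

HB.instance Definition _ := SubChoice.on fg_submod_type.
HB.instance Definition _ :=
  GRing.SubChoice_isSubLmodule.Build _ _ _ fg_submod_type
    (GRing.subsemimodClosedP U).

(* For h in H the default value x of insubd is never used. *)
Definition fg_submod_act (h : gT) (x : fg_submod_type) : fg_submod_type :=
  insubd x (fg_act M h (val x)).

Lemma val_fg_submod_act h x :
  h \in H -> val (fg_submod_act h x) = fg_act M h (val x).
Proof. by move=> hH; rewrite insubdK ?(fg_submod_stable hH) ?(valP x). Qed.

Lemma fg_submod_act_linear : {in H, forall h, linear (fg_submod_act h)}.
Proof.
move=> h hH a x y; apply: val_inj.
by rewrite val_fg_submod_act // !GRing.linearP /= !val_fg_submod_act //
           (fg_act_linear hH).
Qed.

Lemma fg_submod_act1 x : fg_submod_act 1 x = x.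
Proof. by apply: val_inj; rewrite val_fg_submod_act // fg_act1. Qed.

Lemma fg_submod_actM :
  {in H &, forall g h x,
     fg_submod_act (g * h) x = fg_submod_act g (fg_submod_act h x)}.
Proof.
move=> g h gH hH x; apply: val_inj.
by rewrite !val_fg_submod_act ?groupM // (fg_actM gH hH).
Qed.

Definition fg_submod_module : fg_module F H :=
  FGModule fg_submod_act_linear fg_submod_act1 fg_submod_actM.

End SubModule.

Coercion fg_submod_module : fg_submod >-> fg_module.

Fact sgvalX (gT : finGroupType) (P : {group gT}) (x : [subg P]) n :
  sgval (x ^+ n) = sgval x ^+ n.
Proof. by elim: n => // n IHn; rewrite !expgS -IHn. Qed.

Section AbelemModule.

Variables (p : nat) (gT : finGroupType) (P : {group gT}).

(* Alias of [subg P] carrying the additive 'F_p-space structure. *)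
Definition abelem_space (abelP : p.-abelem P) : Type := [subg P].

Variable abelP : p.-abelem P.
Local Notation V := (abelem_space abelP).

HB.instance Definition _ := Finite.on V.

Let add (x y : V) : V := ((x : [subg P]) * (y : [subg P]))%g.
Let opp (x : V) : V := ((x : [subg P])^-1)%g.

Fact abelem_space_addA : associative add.
Proof. exact: mulgA. Qed.
Fact abelem_space_addC : commutative add.
Proof.
have [_ /centsP cPP _] := and3P abelP.
by move=> x y; apply: val_inj; apply: cPP; apply: subgP.
Qed.
Fact abelem_space_add0 : left_id (1 : [subg P]) add.
Proof. exact: mul1g. Qed.
Fact abelem_space_addN : left_inverse (1 : [subg P]) opp add.
Proof. exact: mulVg. Qed.

HB.instance Definition _ := GRing.isZmodule.Build V
  abelem_space_addA abelem_space_addC abelem_space_add0 abelem_space_addN.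

Let scale (a : 'F_p) (x : V) : V := ((x : [subg P]) ^+ a)%g.

(* No primality of p is needed: 'F_p is 'F_(pdiv p), and P is trivial when p is
   not prime. *)
Fact abelem_space_exp (x : [subg P]) n : x ^+ (n %% (Zp_trunc (pdiv p)).+2) = x ^+ n.
Proof.
have [pP _ eP] := and3P abelP.
apply: expg_mod; apply: val_inj; case p_pr: (prime p).
  by rewrite Fp_cast // [LHS]sgvalX (exponentP eP) ?subgP.
suff /eqP P1 : P :==: [set 1].
  have /set1P x1: sgval x \in [set 1] by rewrite -[[set 1]]P1 subgP.
  by rewrite [LHS]sgvalX x1 expg1n.
rewrite trivg_card1 eqn_leq cardG_gt0 andbT leqNgt; apply/negP=> P_gt1.
have := pgroupP pP _ (pdiv_prime P_gt1) (pdiv_dvd _).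
by rewrite inE => /eqP def_p; rewrite -def_p pdiv_prime in p_pr.
Qed.

Fact abelem_space_scaleA a b x : scale a (scale b x) = scale (a * b)%R x.
Proof. by rewrite /scale -expgM mulnC -[LHS]abelem_space_exp. Qed.
Fact abelem_space_scale1 : left_id 1%R scale.
Proof. by move=> x; rewrite /scale -[RHS]expg1. Qed.
Fact abelem_space_scaleDr : right_distributive scale +%R.
Proof. by move=> a x y; rewrite /scale; apply: expgMn; apply: abelem_space_addC. Qed.
Fact abelem_space_scaleDl x : {morph scale^~ x : a b / (a + b)%R}.
Proof. by move=> a b; rewrite /scale abelem_space_exp expgD. Qed.

HB.instance Definition _ := GRing.Zmodule_isLmodule.Build 'F_p V
  abelem_space_scaleA abelem_space_scale1
  abelem_space_scaleDr abelem_space_scaleDl.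

Variables (H : {group gT}) (nPH : H \subset 'N(P)).

(* Left action x |-> h x h^-1, whereas mathcomp's x ^ h is h^-1 x h. *)
Definition conj_act (h : gT) (x : V) : V := subg P (sgval x ^ h^-1).

Lemma sgval_conj_act h x : h \in H -> sgval (conj_act h x) = sgval x ^ h^-1.
Proof.
by move=> hH; rewrite subgK // memJ_norm ?subgP // groupV (subsetP nPH).
Qed.

Lemma conj_act_linear : {in H, forall h, linear (conj_act h)}.
Proof.
move=> h hH a x y; apply: (can_inj sgvalK).
have sgval_comb u v : sgval (a *: u + v : V)%R = sgval u ^+ a * sgval v.
  by rewrite -sgvalX.
by rewrite sgval_comb !sgval_conj_act // sgval_comb conjMg conjXg.
Qed.

Lemma conj_act1 x : conj_act 1 x = x.
Proof.
by apply: (can_inj sgvalK); rewrite sgval_conj_act // invg1 conjg1.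
Qed.

Lemma conj_actM :
  {in H &, forall g h x, conj_act (g * h) x = conj_act g (conj_act h x)}.
Proof.
move=> g h gH hH x; apply: (can_inj sgvalK).
by rewrite !sgval_conj_act ?groupM // invMg conjgM.
Qed.

Definition conj_module : fg_module 'F_p H :=
  FGModule conj_act_linear conj_act1 conj_actM.

End AbelemModule.

Lemma norm_of_factorization (gT : finGroupType) (G P Q R H : {group gT}) :
  P <| G -> P * Q * R = G -> Q * R = H -> H \subset 'N(P).
Proof.
move=> /andP[_ nPG] defG defH; apply: subset_trans nPG.
by rewrite -defG -mulgA defH mulG_subr.
Qed.

(* Main.v *)
(* Averaging over Q, which is possible because p does not divide #|Q|, gives a
   projection of every F_p H-module onto its Q-fixed points; it commutes with H
   because Q is normal in H.  Any H-stable complement of the Q-fixed points is the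
   kernel of this projection, so H-isomorphisms respect both summands.  A
   Q-fixed element of P that is also R-fixed centralises PQR = G. *)
From HB Require Import structures.
Require Import Defs.
From mathcomp Require Import all_boot all_order all_algebra all_fingroup all_solvable.

Set Implicit Arguments.
Unset Strict Implicit.
Unset Printing Implicit Defensive.

Import GRing.Theory.

Local Open Scope group_scope.

(** * Kernels, restrictions and direct sums of [F H]-modules over a field [F] *)

Section Modules.

Variables (F : fieldType) (gT : finGroupType) (H : {group gT}).
Implicit Types (M N : fg_module F H).

(** Linearity of the action is only given on [H], so the bundled map carries the membership proof;
    the generic lemmas on linear maps then apply to it. *)
Definition fg_act_lin M h (hH : h \in H) : {linear M -> M} :=
  HB.pack (fg_act M h) (GRing.isLinear.Build F M M *:%R _ (fg_act_linear hH)).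

Lemma fg_actD M h x y :
  h \in H -> fg_act M h (x + y)%R = (fg_act M h x + fg_act M h y)%R.
Proof. by move=> hH; rewrite -[fg_act M h]/(fg_act_lin M hH : M -> M) linearD. Qed.

(** Source of both summands: it is applied to the average over [Q] and to the identity minus that
    average. *)
Lemma fg_ker_submod M (f : M -> M) :
    linear f -> {in H, forall h x, f (fg_act M h x) = fg_act M h (f x)} ->
  exists U : fg_submod M, forall x, (x \in U) = (f x == 0%R).
Proof.
move=> f_lin fH.
pose fL : {linear M -> M} := HB.pack f (GRing.isLinear.Build F M M *:%R _ f_lin).
pose K : {pred M} := [pred x | fL x == 0%R].
have inK x : (x \in K) = (fL x == 0%R) by [].
have K_closed : subsemimod_closed K.
  split; [split=> [|x y] | move=> a x]; rewrite !inK ?linear0 //.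
    by rewrite linearD => /eqP-> /eqP->; rewrite addr0.
  by rewrite linearZ => /eqP->; rewrite /= scaler0.
pose KS : submodClosed M := HB.pack K (GRing.isSubmodClosed.Build F M K K_closed).
have K_stable : fg_stable H KS.
  move=> h hH x; rewrite !inK /= fH // => /eqP->.
  by rewrite -[fg_act M h]/(fg_act_lin M hH : M -> M) linear0.
by exists (FGSubmod K_stable).
Qed.

Lemma fg_isoI M N (f : M -> N) (g : N -> M) :
    linear f -> cancel f g -> cancel g f ->
    {in H, forall h x, f (fg_act M h x) = fg_act N h (f x)} ->
  fg_iso M N.
Proof.
move=> f_lin fK gK fH.
pose fL : {linear M -> N} := HB.pack f (GRing.isLinear.Build F M N *:%R _ f_lin).
by exists fL => //; exists g.
Qed.

Lemma fg_val_linear M (U : fg_submod M) (x : fg_submod_type U) a y :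
  val (a *: x + y)%R = (a *: val x + val y)%R.
Proof. exact: linearP. Qed.

(** Since membership in [U] is equivalent to membership of the image in [V], the inverse of [f]
    restricts along with [f]. *)
Lemma fg_iso_submod M N (U : fg_submod M) (V : fg_submod N) (f : {linear M -> N}) :
    bijective f -> {in H, forall h x, f (fg_act M h x) = fg_act N h (f x)} ->
    (forall x, (x \in U) = (f x \in V)) ->
  fg_iso U V.
Proof.
move=> [g fK gK] fH fUV.
have fV (x : fg_submod_type U) : f (val x) \in V by rewrite -fUV (valP x).
have gU (y : fg_submod_type V) : g (val y) \in U by rewrite fUV gK (valP y).
pose f1 x : fg_submod_type V := Sub (f (val x)) (fV x).
pose g1 y : fg_submod_type U := Sub (g (val y)) (gU y).
apply: (@fg_isoI U V f1 g1) => [a x y|x|y|h hH x]; apply: val_inj.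
- rewrite [RHS](fg_val_linear (f1 x : fg_submod_type V)) !SubK.
  exact: etrans (congr1 f (fg_val_linear (x : fg_submod_type U) a y)) (linearP f a _ _).
- by rewrite !SubK fK.
- by rewrite !SubK gK.
by rewrite SubK /= !val_fg_submod_act // SubK fH.
Qed.

Lemma submodB (V : lmodType F) (S : submodClosed V) : {in S &, forall x y, (x - y)%R \in S}.
Proof. by move=> x y xS yS; rewrite -scaleN1r rpredD ?rpredZ. Qed.

Lemma fg_direct_sum_proj M (U W : fg_submod M) :
    fg_direct_sum U W ->
  exists (p1 : M -> fg_submod_type U) (p2 : M -> fg_submod_type W),
    (forall x, x = val (p1 x) + val (p2 x))%R
    /\ (forall u w, p1 (val u + val w)%R = u /\ p2 (val u + val w)%R = w).
Proof.
move=> [sumUW UW0].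
(* Recovering the [W]-component as [x - u] leaves a boolean condition on [u] alone, as [xchoose]
   requires. *)
have exU x : exists u, (u \in U) && ((x - u)%R \in W).
  by have [u [w [uU wW ->]]] := sumUW x; exists u; rewrite uU addrC addKr.
pose u x := xchoose (exU x).
have uU x : u x \in U by case/andP: (xchooseP (exU x)).
have wW x : (x - u x)%R \in W by case/andP: (xchooseP (exU x)).
pose p1 x : fg_submod_type U := Sub (u x) (uU x).
pose p2 x : fg_submod_type W := Sub (x - u x)%R (wW x).
exists p1, p2; split=> [x|a b]; first by rewrite !SubK addrC subrK.
set x := (_ + _)%R.
(* For two decompositions of [x], the difference of the [U]-parts is also a difference of [W]-parts,
   so it lies in both submodules and vanishes. *)
have def_x : (val (p1 x) - val a = val b - val (p2 x))%R.
  by rewrite !SubK opprB addrCA; congr (_ + _)%R; rewrite opprD addrCA subrr addr0.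
have p1a : (val (p1 x) - val a)%R = 0%R.
  apply: UW0; first by rewrite submodB ?(valP a) ?(valP (p1 x)).
  by rewrite def_x submodB ?(valP b) ?(valP (p2 x)).
split; apply: val_inj; apply/eqP; first by rewrite -subr_eq0 p1a.
by rewrite eq_sym -subr_eq0 -def_x p1a.
Qed.

Lemma fg_iso_direct_sum M N (U W : fg_submod M) (U' W' : fg_submod N) :
    fg_direct_sum U W -> fg_direct_sum U' W' -> fg_iso U U' -> fg_iso W W' ->
  fg_iso M N.
Proof.
move=> /fg_direct_sum_proj[p1 [p2 [xE pK]]] /fg_direct_sum_proj[p1' [p2' [yE pK']]].
case=> f1 [g1 f1K g1K] f1H [f2 [g2 f2K g2K] f2H].
pose sum (u : fg_submod_type U) (w : fg_submod_type W) := (val u + val w)%R.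
pose sum' (u : fg_submod_type U') (w : fg_submod_type W') := (val u + val w)%R.
pose f x := sum' (f1 (p1 x)) (f2 (p2 x)).
pose g y := sum (g1 (p1' y)) (g2 (p2' y)).
(* Linearity and equivariance of [f] are obtained by first collecting the argument into the form
   [sum u w], where [f] acts componentwise. *)
have fE u w : f (sum u w) = sum' (f1 u) (f2 w) by rewrite /f (pK u w).1 (pK u w).2.
have gE u w : g (sum' u w) = sum (g1 u) (g2 w) by rewrite /g (pK' u w).1 (pK' u w).2.
apply: (@fg_isoI _ _ f g) => [a x y|x|y|h hH x].
- rewrite [x in LHS]xE [y in LHS]xE scalerDr addrACA -!linearP.
  rewrite -/(sum _ _) fE /sum' !linearP /= addrACA -scalerDr //.
- by rewrite /f gE f1K f2K /sum -xE.
- by rewrite /g fE g1K g2K /sum' -yE.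
rewrite [x in LHS]xE fg_actD // -!val_fg_submod_act // -/(sum _ _) fE.
by rewrite /sum' f1H // f2H // !val_fg_submod_act // -fg_actD.
Qed.

End Modules.

(** * Averaging over a normal subgroup whose order is invertible in [F] *)

Section Average.

Variables (F : fieldType) (gT : finGroupType) (H Q : {group gT}).
Hypotheses (nsQH : Q <| H) (Q_neq0 : (#|Q|%:R != 0 :> F)%R).
Implicit Types (M N : fg_module F H).

Let sQH : {subset Q <= H} := subsetP (normal_sub nsQH).

(** The Reynolds operator of [Q]. *)
Definition fg_avg M (x : M) : M := (#|Q|%:R^-1 *: \sum_(h in Q) fg_act M h x)%R.

Lemma fg_avg_linear M : linear (@fg_avg M).
Proof.
move=> a x y; rewrite /fg_avg scalerA mulrC -scalerA -scalerDr; congr (_ *: _)%R.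
rewrite scaler_sumr -big_split; apply: eq_bigr => h hQ.
exact: (fg_act_linear (sQH hQ)).
Qed.

Lemma fg_act_avg M h (x : M) : h \in H -> fg_act M h (fg_avg x) = fg_avg (fg_act M h x).
Proof.
move=> hH; rewrite -[fg_act M h]/(fg_act_lin M hH : M -> M) /fg_avg linearZ linear_sum /=.
(* Replacing [g] by [h * g * h^-1] permutes [Q] by normality, and [h * g * h^-1] applied to [h x] is
   [h * g] applied to [x]. *)
congr (_ *: _)%R; rewrite [RHS](reindex_inj (conjg_inj h^-1)) /=.
apply: eq_big => [g|g gQ].
  by rewrite memJ_norm // groupV (subsetP (normal_norm nsQH)).
have gH := sQH gQ; rewrite -!fg_actM ?groupJ ?groupV //.
by rewrite conjgE invgK mulgA -(mulgA _ h^-1) mulVg mulg1.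
Qed.

Lemma fg_act_avg_id M h (x : M) : h \in Q -> fg_act M h (fg_avg x) = fg_avg x.
Proof.
move=> hQ; have hH := sQH hQ.
rewrite -[fg_act M h]/(fg_act_lin M hH : M -> M) /fg_avg linearZ linear_sum /=.
(* Left translation by [h] permutes [Q]. *)
congr (_ *: _)%R; rewrite [RHS](reindex_inj (mulgI h)) /=.
apply: eq_big => [g|g gQ]; first by rewrite groupMl.
by rewrite fg_actM ?sQH.
Qed.

Lemma fg_avg_fixed M (x : M) : {in Q, forall h, fg_act M h x = x} -> fg_avg x = x.
Proof.
move=> Qx; rewrite /fg_avg (eq_bigr (fun=> x)) // sumr_const -scaler_nat.
by rewrite scalerA mulVf // scale1r.
Qed.

Lemma fg_avg_idP M (x : M) :
  fg_avg x = x <-> {in Q, forall h, fg_act M h x = x}.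
Proof. by split=> [<- h|]; [apply: fg_act_avg_id | apply: fg_avg_fixed]. Qed.

Lemma fg_fixed_decomposition M :
  exists P1 P2 : fg_submod M, fg_direct_sum P1 P2 /\ is_fixed_submod Q P1.
Proof.
have avg_lin := @fg_avg_linear M.
(* The complementary projection: its kernel is the space of [Q]-fixed vectors, and [P2] will be the
   kernel of the average itself. *)
pose f x := (x - fg_avg x : M)%R.
have f_lin : linear f.
  by move=> a x y; rewrite /f avg_lin scalerBr opprD addrACA.
have fH : {in H, forall h x, f (fg_act M h x) = fg_act M h (f x)}.
  move=> h hH x; rewrite /f -fg_act_avg //.
  by rewrite -[fg_act M h]/(fg_act_lin M hH : M -> M) linearB.
have [P1 P1E] := fg_ker_submod f_lin fH.
have [|P2 P2E] := fg_ker_submod avg_lin; first by move=> h hH x; rewrite fg_act_avg.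
have avgK x : fg_avg (fg_avg x) = fg_avg x.
  by apply/fg_avg_idP => h; apply: fg_act_avg_id.
have P1P x : x \in P1 <-> fg_avg x = x.
  by rewrite P1E subr_eq0 eq_sym; split=> /eqP.
exists P1, P2; split=> [|x]; last exact: iff_trans (P1P x) (fg_avg_idP x).
split=> [x|x]; last by move/P1P=> <-; rewrite P2E avgK => /eqP.
exists (fg_avg x), (x - fg_avg x)%R; split; first exact/P1P.
  by rewrite P2E addrC -scaleN1r avg_lin avgK scaleN1r addNr.
by rewrite addrC subrK.
Qed.

(** The average of a vector of [P2] stays in [P2] by stability and is [Q]-fixed, hence is zero.
    Conversely, the average of [u + w] is then [u], so a vector with zero average has no
    [P1]-component. The complement is thus determined by the action. *)
Lemma fg_fixed_complement M (P1 P2 : fg_submod M) :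
    fg_direct_sum P1 P2 -> is_fixed_submod Q P1 ->
  forall x, (x \in P2) = (fg_avg x == 0%R).
Proof.
move=> [sumP P0] P1fix x.
have avg_lin := @fg_avg_linear M.
have avgP2 w : w \in P2 -> fg_avg w = 0%R.
  move=> wP2; apply: P0; first by apply/P1fix => h; apply: fg_act_avg_id.
  by rewrite rpredZ // rpred_sum // => h /sQH hH; apply: (fg_submod_stable hH).
apply/idP/eqP => [/avgP2 //|avgx].
have [u [w [/P1fix uP1 wP2 def_x]]] := sumP x.
move: avgx; rewrite def_x -[u]scale1r avg_lin (avgP2 w) // addr0 scale1r.
by rewrite fg_avg_fixed // => ->; rewrite scaler0 add0r.
Qed.

Lemma fg_iso_fixed_decomposition M N (P1 P2 : fg_submod M) (P1' P2' : fg_submod N) :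
    fg_direct_sum P1 P2 -> is_fixed_submod Q P1 ->
    fg_direct_sum P1' P2' -> is_fixed_submod Q P1' ->
  fg_iso M N <-> fg_iso P1 P1' /\ fg_iso P2 P2'.
Proof.
move=> dsP fixP dsP' fixP'; split=> [[f f_bij fH]|[]]; last exact: fg_iso_direct_sum.
have f_inj := bij_inj f_bij.
split; apply: (fg_iso_submod f_bij fH) => x.
  apply/idP/idP => [/fixP Qx|/fixP' Qfx].
    by apply/fixP' => h hQ; rewrite -fH ?sQH // Qx.
  by apply/fixP => h hQ; apply: f_inj; rewrite fH ?sQH // Qfx.
rewrite (fg_fixed_complement dsP fixP) (fg_fixed_complement dsP' fixP').
(* Both second summands are kernels of averages, so it suffices that [f] commutes with averaging. *)
suff <- : f (fg_avg x) = fg_avg (f x) by rewrite -(inj_eq f_inj) linear0.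
rewrite /fg_avg linearZ linear_sum /=; congr (_ *: _)%R.
by apply: eq_bigr => h /sQH hH; apply: fH.
Qed.

(** Vectors on which [Q] acts trivially lie in [P1], which meets [P2] in zero. *)
Lemma fg_fixed_complement_no_trivial M (P1 P2 : fg_submod M) :
    fg_direct_sum P1 P2 -> is_fixed_submod Q P1 -> no_nonzero_trivial_submod Q P2.
Proof.
move=> [_ P0] fixP S sSP2 _ trivS x xS; apply: P0; last exact: sSP2.
by apply/fixP => h hQ; apply: trivS.
Qed.

End Average.
Theorem theorem4p5 (p q r : nat)
    (p_prime : prime p) (q_prime : prime q) (r_prime : prime r)
    (neq_pq : p != q) (neq_pr : p != r) (neq_qr : q != r)
    (gT : finGroupType) (G P Q R H : {group gT})
    (varG : variety_prod (abelian_variety p)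
              (variety_prod (abelian_variety q) (abelian_variety r)) G)
    (centreG : 'Z(G) = 1)
    (defG : P * Q * R = G)
    (nsPG : P <| G)
    (sylP : p.-Sylow(G) P) (sylQ : q.-Sylow(G) Q) (sylR : r.-Sylow(G) R)
    (abelP : p.-abelem P) (abelQ : q.-abelem Q) (abelR : r.-abelem R)
    (defH : Q * R = H)
    (varH : variety_prod (abelian_variety q) (abelian_variety r) H)
    (nsPQG : P * Q <| G) :
  let M : fg_module 'F_p H :=
    conj_module abelP (norm_of_factorization nsPG defG defH) in
  [/\ (exists P1 P2 : fg_submod M, fg_direct_sum P1 P2 /\ is_fixed_submod Q P1),
      (forall P1 P2 : fg_submod M,
         fg_direct_sum P1 P2 -> is_fixed_submod Q P1 ->
         no_nonzero_trivial_submod R P1 /\ no_nonzero_trivial_submod Q P2)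
    & (forall P1 P2 : fg_submod M,
         fg_direct_sum P1 P2 -> is_fixed_submod Q P1 ->
       forall (M' : fg_module 'F_p H) (P1' P2' : fg_submod M'),
         fg_direct_sum P1' P2' -> is_fixed_submod Q P1' ->
         fg_iso M M' <-> fg_iso P1 P1' /\ fg_iso P2 P2')].
Proof.
move=> M.
have sQH : Q \subset H by rewrite -defH mulG_subl.
have nPH := norm_of_factorization nsPG defG defH.
have p'Q : p^'.-group Q.
  by apply: pi_pgroup (abelem_pgroup abelQ) _; rewrite !inE eq_sym.
have p'R : p^'.-group R.
  by apply: pi_pgroup (abelem_pgroup abelR) _; rewrite !inE eq_sym.
have Q_neq0 : (#|Q|%:R != 0 :> 'F_p)%R.
  by rewrite -(dvdn_pcharf (pchar_Fp p_prime)) -p'natE.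
(* The order of [H] divides that of [Q] times that of [R], so [H] meets [P] trivially. The modular
   law then gives [Q] as the intersection of [H] with the normal subgroup [P * Q]. *)
have nsQH : Q <| H.
  have tiHP : H :&: P = 1.
    rewrite setIC; apply/coprime_TIg/(coprime_dvdr (n := (#|Q| * #|R|)%N)).
      by rewrite mul_cardG defH dvdn_mulr.
    by rewrite coprimeMr !(pnat_coprime (abelem_pgroup abelP)).
  have sHG : H \subset G by rewrite -defG -mulgA defH mulG_subr.
  have <- : H :&: (P * Q) = Q by rewrite -group_modr // tiHP mul1g.
  exact: normalGI sHG nsPQG.
split; first exact: fg_fixed_decomposition.
  move=> P1 P2 dsP fixP; split; last exact: fg_fixed_complement_no_trivial dsP fixP.
  move=> S sSP1 _ trivS x xS.
  (* As [h] acts by [x ^ h^-1], being fixed by [h] means commuting with [h^-1], equivalently with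
     [h]. *)
  have cent (K : {group gT}) :
      K \subset H -> {in K, forall h, fg_act M h x = x} -> K \subset 'C[sgval x].
    move=> sKH Kx; apply/subsetP => h hK; have hH := subsetP sKH h hK.
    rewrite -groupV cent1C; apply/cent1P/commgP/conjg_fixP.
    by rewrite -(sgval_conj_act nPH) //; apply: congr1 (Kx h hK).
  (* The three factors centralise [x] for different reasons: [P] is abelian, [x] lies in the
     [Q]-fixed summand, and [R] is trivial on [S]. *)
  have cPx : P \subset 'C[sgval x].
    by rewrite sub_cent1 (subsetP (abelem_abelian abelP)) ?subgP.
  have cQx := cent Q sQH ((fixP x).1 (sSP1 x xS)).
  have cRx : R \subset 'C[sgval x].
    by apply: cent => [|h hR]; [rewrite -defH mulG_subr | apply: trivS].
  have : sgval x \in 'Z(G).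
    rewrite inE (subsetP (normal_sub nsPG)) ?subgP //=.
    by rewrite -sub_cent1 -defG !mul_subG.
  by rewrite centreG => /set1P x1; apply: val_inj.
move=> P1 P2 dsP fixP M' P1' P2' dsP' fixP'.
exact: (fg_iso_fixed_decomposition nsQH Q_neq0 dsP fixP dsP' fixP').
Qed.
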